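(* Let $\mathcal{H}$ be a linear and $3$-uniform hypergraph with $n$ vertices and $m$ edges, where $m\ge 3$. If $k$ is a positive integer with $k\ge \frac{1.185(m-1)}{\log(m-1)}$ and $L$ is a $k$-assignment of $\mathcal{H}$ with $\alpha(\mathcal{H},L)>0$, then $$P(\mathcal{H},L)-P(\mathcal{H},k)>\frac{0.002\log(m-1)}{(m-1)^{0.156}}\cdot k^{n-3}\,\alpha(\mathcal{H},L).$$ Hence $P_l(\mathcal{H},k)=P(\mathcal{H},k)$ holds for every positive integer $k$ with $k\ge \frac{1.185(m-1)}{\log(m-1)}$.
   Context: All hypergraphs $\mathcal{H}$ are finite, with vertex set $V(\mathcal{H})$ and edge set $E(\mathcal{H})$ (a set of subsets of $V(\mathcal{H})$), where $|e|\ge 2$ for every edge $e$ and $e_1\not\subseteq e_2$ for any two distinct edges $e_1,e_2$. $\mathcal{H}$ is $r$-uniform if $|e|=r$ for every edge $e$, and linear if $|e_1\cap e_2|\le 1$ for any two distinct edges $e_1,e_2$. $\mathbb{N}$ is the set of positive integers, $[k]=\{1,\dots,k\}$, and $\log$ is the natural logarithm. For $k\in\mathbb{N}$, a proper $k$-coloring of $\mathcal{H}$ is a map $\theta:V(\mathcal{H})\to[k]$ such that $|\{\theta(v): v\in e\}|\ge 2$ for each edge $e$; $P(\mathcal{H},k)$ is the number of proper $k$-colorings. A $k$-assignment $L$ of $\mathcal{H}$ assigns to each vertex $v$ a set $L(v)\subseteq\mathbb{N}$ with $|L(v)|=k$. An $L$-coloring is a map $\theta:V(\mathcal{H})\to\mathbb{N}$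 with $\theta(v)\in L(v)$ for all $v$ and $|\{\theta(v): v\in e\}|\ge 2$ for each edge $e$; $P(\mathcal{H},L)$ is the number of $L$-colorings. The list-color function $P_l(\mathcal{H},k)$ is the minimum of $P(\mathcal{H},L)$ over all $k$-assignments $L$ of $\mathcal{H}$. For a $k$-assignment $L$ and an edge $e$, $\alpha(e,L):=k-\left|\bigcap_{v\in e}L(v)\right|$, and $\alpha(\mathcal{H},L):=\sum_{e\in E(\mathcal{H})}\alpha(e,L)$. *)

(* Defs.v *)
From mathcomp Require Import all_boot order finmap.
From mathcomp Require Import boolp classical_sets functions cardinality.

Set Implicit Arguments.
Unset Strict Implicit.
Unset Printing Implicit Defensive.

Local Open Scope fset_scope.
Local Open Scope classical_set_scope.
Local Open Scope nat_scope.

Record hypergraph (V : finType) := Hypergraph {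
  edges : {set {set V}};
  edges_card : forall e, e \in edges -> 2 <= #|e|;
  edges_antichain : forall e1 e2,
    e1 \in edges -> e2 \in edges -> e1 != e2 -> ~~ (e1 \subset e2)
}.

Definition uniform_hypergraph (V : finType) (r : nat) (H : hypergraph V) :=
  forall e, e \in edges H -> #|e| = r.

Definition linear_hypergraph (V : finType) (H : hypergraph V) :=
  forall e1 e2, e1 \in edges H -> e2 \in edges H -> e1 != e2 ->
    #|e1 :&: e2| <= 1.

Definition no_monochromatic_edge (V : finType) (H : hypergraph V)
    (theta : {ffun V -> nat}) :=
  forall e : {set V}, e \in edges H -> 2 <= #|` [fset theta v | v in e]%fset|.

Definition proper_colorings (V : finType) (H : hypergraph V) (k : nat) :
    set {ffun V -> nat} :=
  [set theta : {ffun V -> nat} | (forall v, 1 <= theta v <= k) /\ no_monochromatic_edge H theta].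

Definition assignment (V : finType) (k : nat) (L : V -> {fset nat}) :=
  forall v, #|` L v| = k /\ (forall c, c \in L v -> 0 < c).

Definition list_colorings (V : finType) (H : hypergraph V)
    (L : V -> {fset nat}) : set {ffun V -> nat} :=
  [set theta : {ffun V -> nat} | (forall v, theta v \in L v) /\ no_monochromatic_edge H theta].

Lemma list_colorings_finite (V : finType) (H : hypergraph V)
    (L : V -> {fset nat}) : finite_set (list_colorings H L).
Proof.
set U := (\bigcup_(v in V) L v)%fset.
pose f (g : {ffun V -> U}) : {ffun V -> nat} := [ffun v => val (g v)].
apply: (@sub_finite_set _ _ (range f)); last exact/finite_image/finite_finset.
move=> theta [thetaL _].
have thetaU v : theta v \in U by apply/bigfcupP; exists v; rewrite ?mem_index_enum ?inE.
exists [ffun v => [` thetaU v]] => //.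
by apply/ffunP => v; rewrite !ffunE.
Qed.

Definition constant_assignment (V : finType) (k : nat) : V -> {fset nat} :=
  fun=> [fset c in iota 1 k]%fset.

Lemma constant_assignmentP (V : finType) (k : nat) :
  assignment k (@constant_assignment V k).
Proof.
move=> v; split; last by move=> c; rewrite !inE mem_iota => /andP[].
by rewrite card_fseq undup_id ?iota_uniq// size_iota.
Qed.

Lemma proper_coloringsE (V : finType) (H : hypergraph V) (k : nat) :
  proper_colorings H k = list_colorings H (@constant_assignment V k).
Proof.
apply/seteqP; split=> theta [thetaL ?]; split=> // v; move: (thetaL v);
  by rewrite !inE mem_iota add1n ltnS.
Qed.

Lemma proper_colorings_finite (V : finType) (H : hypergraph V) (k : nat) :
  finite_set (proper_colorings H k).
Proof. by rewrite proper_coloringsE; exact: list_colorings_finite. Qed.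

(* [fset_set] is the empty set on infinite sets; the two finiteness lemmas
   above show that the following cardinals are the genuine ones. *)
Definition chromatic_count (V : finType) (H : hypergraph V) (k : nat) : nat :=
  #|` fset_set (proper_colorings H k)|.

Definition list_color_count (V : finType) (H : hypergraph V)
    (L : V -> {fset nat}) : nat :=
  #|` fset_set (list_colorings H L)|.

Lemma list_color_count_exists (V : finType) (H : hypergraph V) (k : nat) :
  exists N, `[< exists2 L : V -> {fset nat},
                  assignment k L & list_color_count H L = N >].
Proof.
exists (list_color_count H (@constant_assignment V k)); apply/asboolP.
by exists (@constant_assignment V k) => //; exact: constant_assignmentP.
Qed.

Definition list_color_function (V : finType) (H : hypergraph V) (k : nat) :
    nat :=
  ex_minn (list_color_count_exists H k).

(* {fset nat} has no greatest element, so the intersection over an edge is cut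
   out of the union; the two agree with the usual one since edges are
   nonempty. *)
Definition edge_common_colors (V : finType) (L : V -> {fset nat})
    (e : {set V}) : {fset nat} :=
  [fset c in (\bigcup_(v in e) L v)%fset | [forall v in e, c \in L v]]%fset.

(* For a k-assignment and a nonempty edge the truncated subtraction is exact,
   as the common colors lie in a list of k elements. *)
Definition alpha_edge (V : finType) (k : nat) (L : V -> {fset nat})
    (e : {set V}) : nat :=
  k - #|` edge_common_colors L e|.

Definition alpha (V : finType) (k : nat) (H : hypergraph V)
    (L : V -> {fset nat}) : nat :=
  \sum_(e in edges H) alpha_edge k L e.

(* Main.v *)
Require Import Defs.
From mathcomp Require Import all_boot all_order all_algebra finmap.
From mathcomp Require Import reals exp.
From mathcomp Require Import ring lra zify sequences.
From mathcomp Require boolp classical_sets cardinality.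
Import Order.TTheory GRing.Theory Num.Theory.
Local Open Scope ring_scope.

(** Order the edges, and let [N(F, s)] be the number of [L]-colorings for which
the edges in [F] are monochromatic and those in [s] are not. Deletion and
contraction give [N(F, e :: s) = N(F, s) - N(F + e, s)], and the right-hand
side vanishes as soon as [e] lies in a connected component of [F]; otherwise
adding [e] to [F] merges components. With [s] empty, [N(F, [::])] is the product
over the components of the number of colors common to all their vertices; it
differs from its value for constant lists by a fraction at most [alpha(F)/k].
Unfolding the recursion bounds the gap between constant lists and [L]: each edge
contributes the main term [k^(n-3) alpha(e)], and since in a linear 3-uniform
hypergraph the first two edges added each lower the number of components by 2
and the later ones by at least 1, the unfavorable terms, those with an even
number of edges, amount to at most a fraction
[sum_(j odd) C(m-1, j) k^-(j+1) < exp((m-1)/k) / (2k)] of it. *)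

Set Implicit Arguments.
Unset Strict Implicit.

(** * Partitions of the vertex set, encoded by representatives *)

Section Contraction.
Variable V : finType.
Implicit Types (r : V -> V) (e f : {set V}) (s : seq {set V}).

(* An idempotent map [r] encodes a partition of [V]: it sends each vertex to the
   representative of its block. [merge r e] joins the blocks meeting [e]. *)
Definition merge r e v :=
  if r v \in r @: e then odflt v [pick x in r @: e] else r v.

Definition roots r : {set V} := [set v | r v == v].

(** The picked representative depends only on [r] and [e], so a single [w] serves all vertices; [e]
    being nonempty, the default of [odflt] is never reached. *)
Lemma mergeP r e : e != set0 ->
  exists2 w, w \in e & merge r e =1 (fun v => if r v \in r @: e then r w else r v).
Proof.
case/set0Pn=> w0 w0e; rewrite /merge.
case: pickP => [x xe|/(_ (r w0))]; last by rewrite imset_f.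
by have /imsetP[w we ->] := xe; exists w.
Qed.

Lemma merge_idem r e : e != set0 -> idempotent_fun r -> idempotent_fun (merge r e).
Proof.
move=> e0 rr v; have [w we rE] := mergeP r e0.
have rrE u : r (r u) = r u := rr u.
rewrite /= [merge r e v]rE; case: ifP => rv; rewrite rE rrE ?rv ?imset_f //.
Qed.

Lemma root_image r e : idempotent_fun r -> r @: e \subset roots r.
Proof.
by move=> rr; apply/subsetP => _ /imsetP[u _ ->]; rewrite inE; apply/eqP/(rr u).
Qed.

Lemma roots_merge r e w : idempotent_fun r -> w \in e ->
    merge r e =1 (fun v => if r v \in r @: e then r w else r v) ->
  roots (merge r e) = r w |: (roots r :\: r @: e).
Proof.
move=> rr we rE; have rrE u : r (r u) = r u := rr u.
apply/setP => v; rewrite !inE rE; case: ifP => rv; last first.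
  have [->|_] /= := eqVneq v (r w); first by rewrite rrE eqxx.
  have [vr|//] := eqVneq (r v) v; first by rewrite -vr rv.
  by rewrite andbF.
rewrite [r w == v]eq_sym; have [//|_] /= := eqVneq v (r w).
have [vr|_] := eqVneq (r v) v; first by rewrite -vr rv.
by rewrite andbF.
Qed.

(** The [#|r @: e|] blocks that meet [e] become one, and the others survive. *)
Lemma card_roots_merge r e : e != set0 -> idempotent_fun r ->
  (#|roots (merge r e)| + #|r @: e| = (#|roots r|).+1)%N.
Proof.
move=> e0 rr; have [w we /roots_merge-> //] := mergeP r e0.
rewrite cardsU1 !inE imset_f //= add1n addSn cardsD.
have /setIidPr -> := root_image e rr.
by rewrite subnK // subset_leq_card // root_image.
Qed.

Let idid : idempotent_fun (id : V -> V). Proof. by []. Qed.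

Lemma roots_id : roots id = [set: V].
Proof. by apply/setP => v; rewrite !inE eqxx. Qed.

(** * Counting list colorings that are constant on the blocks *)

Section Count.
Variable C : finType.
Implicit Types (L : V -> {set C}) (theta : {ffun V -> C}).

Definition mono theta e := [forall u in e, forall v in e, theta u == theta v].

(** This is the count [N(F, s)], with [F] replaced by the partition [r] into its components: only
    these matter. *)
Definition num_colorings L r s := #|[set theta : {ffun V -> C} |
  [forall v, (theta v \in L v) && (theta v == theta (r v))]
  && all (fun e => ~~ mono theta e) s]|.

Lemma monoP theta e : reflect {in e &, forall u v, theta u = theta v} (mono theta e).
Proof.
apply: (iffP forall_inP) => [h u v ue ve|h u ue].
  by apply/eqP; apply: (forall_inP (h u ue)).
by apply/forall_inP => v ve; apply/eqP/h.
Qed.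

(** Deletion and contraction: a coloring constant on the blocks of [r] and monochromatic on [e] is
    the same as one constant on the blocks of [merge r e]. *)
Lemma num_colorings_cons L r e s : e != set0 -> idempotent_fun r ->
  num_colorings L r s = (num_colorings L r (e :: s) + num_colorings L (merge r e) s)%N.
Proof.
move=> e0 rr; have [w we rE] := mergeP r e0.
have rrE u : r (r u) = r u := rr u.
rewrite /num_colorings addnC -(cardsID [set theta | mono theta e]).
congr (_ + _)%N; apply: eq_card => theta; rewrite !inE /=; last first.
  by rewrite andbCA.
rewrite andbAC; congr (_ && _); apply/andP/forallP => [[/forallP h /monoP m] v|h].
  have [hv /eqP hr] := andP (h v); rewrite hv /= rE; case: ifP => [|_]; last exact/eqP.
  have hR u : theta (r u) = theta u by case/andP: (h u) => _ /eqP.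
  by case/imsetP => u ue ru; rewrite hr ru !hR (m u w).
have hL v : theta v \in L v by case/andP: (h v).
have hR v : theta v = if r v \in r @: e then theta (r w) else theta (r v).
  by case/andP: (h v) => _ /eqP {1}->; rewrite rE; case: ifP.
split; last first.
  by apply/monoP => u v ue ve; rewrite hR [RHS]hR !imset_f.
apply/forallP => v; rewrite hL /=; apply/eqP; rewrite hR [RHS]hR rrE.
by case: ifP.
Qed.

(** The colors available to the whole block of [x]. If no vertex is sent to [x], this is all of [C],
    so products and sums below range over the roots only. *)
Definition common L r x : {set C} := [set c | [forall u, (r u == x) ==> (c \in L u)]].

Lemma commonP L r x c :
  reflect (forall u, r u = x -> c \in L u) (c \in common L r x).
Proof.
rewrite inE; apply: (iffP forallP) => h u; last by apply/implyP => /eqP/h.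
by move/eqP; apply/implyP.
Qed.

(** Such a coloring is a free choice, for each root, of a color common to its block. *)
Lemma num_colorings_nil (c0 : C) L r : idempotent_fun r ->
  num_colorings L r [::] = (\prod_(x in roots r) #|common L r x|)%N.
Proof.
move=> rr; have rrE u : r (r u) = r u := rr u.
have -> : (\prod_(x in roots r) #|common L r x|
    = #|pfamily c0 (mem (roots r)) (fun x => mem (common L r x))|)%N.
  by rewrite card_pfamily foldrE big_image.
(* [f] spreads the color of each root over its block. It is injective on the family because every
   member takes the value [c0] off the roots. *)
pose f theta := [ffun v => theta (r v)] : {ffun V -> C}.
rewrite -(card_in_imset (f := f)); last first.
  move=> t1 t2 /pfamilyP[s1 _] /pfamilyP[s2 _] /ffunP e12; apply/ffunP => v.
  have [vr|vr] := boolP (v \in roots r).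
    by move: (e12 v); rewrite !ffunE; move: vr; rewrite inE => /eqP ->.
  have out t : c0.-support t \subset roots r -> t v = c0.
    by move=> /supportP -> .
  by rewrite !out.
apply: eq_card => theta; rewrite !inE andbT; apply/forallP/imsetP.
  move=> h; exists [ffun v => if v \in roots r then theta v else c0].
    apply/pfamilyP; split.
      by apply/supportP => v vr; rewrite ffunE (negPf vr).
    move=> x xr; rewrite ffunE xr; apply/commonP => u ux.
    by have /andP[hu /eqP hr] := h u; rewrite -ux -hr.
  apply/ffunP => v; rewrite !ffunE inE rrE eqxx.
  by have /andP[_ /eqP] := h v.
case=> t /pfamilyP[_ ht] -> v; rewrite !ffunE rrE eqxx andbT.
by have /commonP := ht (r v) (subsetP (root_image setT rr) _ (imset_f _ (in_setT v))); apply.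
Qed.


Definition edge_common L e : {set C} := [set c | [forall v in e, c \in L v]].

Definition edge_defect (k : nat) L e := (k - #|edge_common L e|)%N.

Definition defect (k : nat) L r := (\sum_(x in roots r) (k - #|common L r x|))%N.

Lemma common_sub L r x u : r u = x -> common L r x \subset L u.
Proof. by move=> ux; apply/subsetP => c /commonP; apply. Qed.

Lemma common_id L v : common L id v = L v.
Proof. by apply/setP => c; apply/commonP/idP => [|cv u ->] //; exact. Qed.

Lemma defect_id (k : nat) L : (forall v, #|L v| = k) -> defect k L id = 0%N.
Proof. by move=> Lk; apply: big1 => v _; rewrite common_id Lk subnn. Qed.

(** A color common to [e] but not to the merged block is missing at some vertex of that block, hence
    from the common colors of one of the old blocks that meet [e]. *)
Lemma common_merge L r e w : idempotent_fun r -> w \in e ->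
    merge r e =1 (fun v => if r v \in r @: e then r w else r v) ->
  (forall x, x \in roots r -> x \notin r @: e ->
     common L (merge r e) x = common L r x) /\
  edge_common L e \subset
    common L (merge r e) (r w) :|:
    \bigcup_(x in r @: e) (edge_common L e :\: common L r x).
Proof.
move=> rr we rE; have rrE u : r (r u) = r u := rr u; split.
  move=> x xr xe; apply/setP => c; apply/commonP/commonP => h u ux; apply: h.
    by rewrite rE ux (negPf xe).
  move: ux; rewrite rE; case: ifP => // _ xw.
  by move: xe; rewrite -xw imset_f.
apply/subsetP => c ce; rewrite inE; have [//|cn] := boolP (c \in common _ _ _).
have [u /eqP ux cu] : exists2 u, merge r e u == r w & c \notin L u.
  move: cn; rewrite inE negb_forall => /existsP[u]; rewrite negb_imply.
  by case/andP; exists u.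
apply/bigcupP; exists (r u).
  have [//|ue] := boolP (r u \in r @: e).
  by move: ux; rewrite rE (negPf ue) /= => ur; rewrite ur imset_f in ue.
by rewrite inE ce andbT; apply: contra cu => /commonP; apply.
Qed.

(** Union bound on the colors lost by the merged block. Iterated from [id], whose defect is zero, it
    bounds the defect by the sum of [edge_defect] over the contracted edges. *)
Lemma defect_merge (k : nat) L r e : (forall v, #|L v| = k) ->
    e != set0 -> idempotent_fun r ->
  (defect k L (merge r e) <= defect k L r + edge_defect k L e)%N.
Proof.
move=> Lk e0 rr; have [w we rE] := mergeP r e0.
have rrE u : r (r u) = r u := rr u.
have [old new] := common_merge L rr we rE.
have wN : r w \notin roots r :\: r @: e by rewrite inE imset_f.
rewrite /defect (roots_merge rr we rE) // big_setU1 //=.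
rewrite [X in (_ <= X + _)%N](big_setID (r @: e)) /=.
rewrite (setIidPr (root_image e rr)) addnAC leq_add //; last first.
  by apply: eq_leq; apply: eq_bigr => x; rewrite inE => /andP[xe xr]; rewrite old.
have ceL v : v \in e -> edge_common L e \subset L v.
  by move=> ve; apply/subsetP => c; rewrite inE => /forall_inP; apply.
have cek : (#|edge_common L e| <= k)%N by rewrite -(Lk w) subset_leq_card ?ceL.
(* Both color sets lie in the list of a vertex [v] of [e] in this block, and that list has exactly
   [k] colors. *)
have small x : x \in r @: e ->
    (#|edge_common L e :\: common L r x| <= k - #|common L r x|)%N.
  case/imsetP => v ve ->; have := cardsD (L v) (common L r (r v)).
  rewrite (setIidPr (common_sub L erefl)) Lk => <-.
  by rewrite subset_leq_card // setSD // ceL.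
have big : (#|\bigcup_(x in r @: e) (edge_common L e :\: common L r x)|
    <= \sum_(x in r @: e) (k - #|common L r x|))%N.
  apply: (leq_trans _ (leq_sum _ small)); elim/big_rec2: _ => [|x n B _ IH].
    by rewrite cards0.
  by rewrite (leq_trans (leq_card_setU _ _)) ?leq_add2l.
have := leq_trans (subset_leq_card new) (leq_card_setU _ _).
rewrite /edge_defect; lia.
Qed.

(** Here [e] lies inside one block, so it is monochromatic in every coloring considered. *)
Lemma num_colorings_mono0 L r e s : #|r @: e| = 1%N -> num_colorings L r (e :: s) = 0%N.
Proof.
move=> /eqP/cards1P[w ew]; apply/eqP; rewrite cards_eq0; apply/eqP/setP => theta.
rewrite !inE /=; apply/negP => /andP[/forallP h /andP[/monoP[]]].
have rw u : u \in e -> r u = w by move=> ue; apply/set1P; rewrite -ew imset_f.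
move=> u v /rw ru /rw rv; have /andP[_ /eqP ->] := h u.
by have /andP[_ /eqP ->] := h v; rewrite ru rv.
Qed.

End Count.

(** * The gap between constant lists and [L] under contraction *)

Section Bounds.
Variables (R : realFieldType) (C : finType) (k : nat).
Variables (A : {set C}) (L : V -> {set C}).
Hypotheses (k_gt0 : (0 < k)%N) (cardA : #|A| = k) (cardL : forall v, #|L v| = k).

Let x : R := k%:R^-1.

(* The sums of ['C(n, j) * x ^+ j] over the even, resp. odd, [j]. *)
Definition even_part n : R := ((1 + x) ^+ n + (1 - x) ^+ n) / 2%:R.
Definition odd_part n : R := ((1 + x) ^+ n - (1 - x) ^+ n) / 2%:R.

Let x_ge0 : 0 <= x. Proof. by rewrite invr_ge0. Qed.
Let kx : k%:R * x = 1. Proof. by rewrite divff // pnatr_eq0 -lt0n. Qed.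
Let x_le1 : x <= 1. Proof. by rewrite invf_le1 ?ltr0n // ler1n. Qed.

Lemma even_partS n : even_part n.+1 = even_part n + x * odd_part n.
Proof. by rewrite /even_part /odd_part !exprS; field. Qed.

Lemma odd_partS n : odd_part n.+1 = odd_part n + x * even_part n.
Proof. by rewrite /even_part /odd_part !exprS; field. Qed.

Lemma even_part0 : even_part 0 = 1. Proof. by rewrite /even_part !expr0; field. Qed.
Lemma odd_part0 : odd_part 0 = 0. Proof. by rewrite /odd_part !expr0; field. Qed.

Lemma parts_ge0 n : 0 <= even_part n /\ 0 <= odd_part n.
Proof.
elim: n => [|n [e0 o0]]; first by rewrite even_part0 odd_part0 ler01 lexx.
rewrite even_partS odd_partS; split; apply: addr_ge0 => //; exact: mulr_ge0.
Qed.

(** With [d_i = k - b i], this is the inequality [1 - sum d_i / k <= prod (1 - d_i / k) <= 1],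
    scaled by a power of [k]. *)
Lemma prod_defect (I : finType) (S : {set I}) (b : I -> nat) :
    (forall i, i \in S -> b i <= k)%N ->
  0 <= (k%:R : R) ^+ #|S| - (\prod_(i in S) b i)%:R
    <= k%:R ^+ #|S| * x * (\sum_(i in S) (k - b i))%:R.
Proof.
move=> bk; have key (s : seq I) : {subset s <= S} ->
    0 <= (k%:R : R) ^+ size s - (\prod_(i <- s) b i)%:R
      <= k%:R ^+ size s * x * (\sum_(i <- s) (k - b i))%:R; last first.
  by have := key (enum S); rewrite -cardE !big_enum; apply=> i; rewrite mem_enum.
elim: s => [_|i s IH sS]; first by rewrite !big_nil /= expr0 subrr mulr0 lexx.
have iS : i \in S by apply: sS; rewrite mem_head.
have {}IH : _ := IH (fun j js => sS j (mem_behead (s := i :: s) js)).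
rewrite !big_cons /= natrM natrD natrB ?bk // exprS.
have /andP[h1 h2] := IH.
have b1 : (b i)%:R <= k%:R :> R by rewrite ler_nat bk.
have b0 : 0 <= (b i)%:R :> R by [].
move: h1 h2; set P := (\prod_(j <- s) _)%:R; set S' := (\sum_(j <- s) _)%:R.
set K := k%:R ^+ size s; set B := (b i)%:R => h1 h2.
have K0 : 0 <= K by rewrite exprn_ge0.
have P0 : 0 <= P by [].
have -> : k%:R * K * x = K by rewrite mulrAC kx mul1r.
have -> : k%:R * K - B * P = k%:R * (K - P) + (k%:R - B) * P by ring.
rewrite addr_ge0 ?mulr_ge0 ?subr_ge0 //= ?ler0n //; last by rewrite -subr_ge0.
have u1 : (k%:R - B) * P <= (k%:R - B) * K.
  by rewrite ler_wpM2l ?subr_ge0 // -subr_ge0.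
have u2 : k%:R * (K - P) <= K * S'.
  apply: (le_trans (ler_wpM2l (ler0n _ _) h2)).
  by rewrite -[K * x]mulrC !mulrA kx mul1r.
lra.
Qed.

(** [A] plays the constant list. The goal is a negative upper bound at [r = id] with [s] listing all
    edges. *)
Definition gap r s : R := (num_colorings (fun=> A) r s)%:R - (num_colorings L r s)%:R.

Lemma gap_cons r e s : e != set0 -> idempotent_fun r ->
  gap r (e :: s) = gap r s - gap (merge r e) s.
Proof.
by move=> e0 rr; rewrite /gap !(num_colorings_cons _ s e0 rr) !natrD; ring.
Qed.

Let card_common r v : idempotent_fun r -> v \in roots r -> (#|common L r v| <= k)%N.
Proof.
by move=> rr; rewrite inE => /eqP vr; rewrite -(cardL v) subset_leq_card ?common_sub.
Qed.

Lemma gap_nil r : idempotent_fun r ->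
  gap r [::] = k%:R ^+ #|roots r| - (\prod_(v in roots r) #|common L r v|)%:R.
Proof.
move=> rr; have [c0 _] : exists c, c \in A by apply/card_gt0P; rewrite cardA.
rewrite /gap !(num_colorings_nil c0) //; congr (_ - _).
rewrite (eq_bigr (fun=> k)); first by rewrite prod_nat_const natrX.
move=> v; rewrite inE => /eqP vr; rewrite -cardA; congr #|pred_of_set _|.
by apply/setP => c; apply/commonP/idP => [|? ? _ //]; apply; apply: vr.
Qed.

Let alphas s : R := (\sum_(e <- s) edge_defect k L e)%:R.

(* [w] accounts for the edges already contracted, [alphas s] for those of [s];
   a term of even (odd) order can only increase (decrease) the gap. *)
Lemma gap_bounds s r (K w : R) :
    {in s, forall e, e != set0} -> idempotent_fun r ->
    k%:R ^+ #|roots r| <= K -> (defect k L r)%:R <= w ->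
  gap r s <= K * x * (even_part (size s) * w + x * odd_part (size s).-1 * alphas s) /\
  - gap r s <= K * x * (odd_part (size s) * w + x * even_part (size s).-1 * alphas s).
Proof.
elim: s r K w => [|e s IH] r K w s0 rr rK rw.
  have /andP[g0 g1] := prod_defect (fun v => card_common (v := v) rr).
  rewrite gap_nil // even_part0 odd_part0 /alphas big_nil !mulr0 mul0r !addr0 mul1r mulr0.
  split; last by rewrite oppr_le0.
  by apply: (le_trans g1); rewrite ler_pM ?mulr_ge0 ?exprn_ge0 ?ler_wpM2r.
have K0 : 0 <= K by apply: le_trans rK; rewrite exprn_ge0.
have w0 : 0 <= w by apply: le_trans rw.
have e0 : e != set0 by rewrite s0 ?mem_head.
have a0 : 0 <= alphas (e :: s) by [].
have [ev0 od0] := parts_ge0 (size s); have [ev1 od1] := parts_ge0 (size s).+1.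
have [re1|re1] := eqVneq #|r @: e| 1%N.
  have bound_ge0 p q : 0 <= p -> 0 <= q ->
      0 <= K * x * (p * w + x * q * alphas (e :: s)).
    by move=> p0 q0; apply: mulr_ge0; [|apply: addr_ge0]; do ?apply: mulr_ge0.
  by rewrite /gap !num_colorings_mono0 // subrr oppr0; split; apply: bound_ge0.
have re2 : (1 < #|r @: e|)%N.
  rewrite ltn_neqAle eq_sym re1 card_gt0; case/set0Pn: e0 => v ve.
  by apply/set0Pn; exists (r v); rewrite imset_f.
have s0' : {in s, forall e, e != set0} by move=> f fs; rewrite s0 // inE fs orbT.
(* At least two blocks meet [e], so contraction loses at least one root, worth a factor [x]. *)
have rK' : k%:R ^+ #|roots (merge r e)| <= K * x.
  have := card_roots_merge e0 rr => cr.
  rewrite -ler_pdivrMr ?invr_gt0 ?ltr0n // invrK -exprSr; apply: le_trans rK.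
  by rewrite ler_weXn2l ?ler1n // -ltnS -cr -addn1 ltn_add2l.
have rw' : (defect k L (merge r e))%:R <= w + (edge_defect k L e)%:R.
  by apply: le_trans (lerD rw (lexx _)); rewrite -natrD ler_nat defect_merge.
have [u1 l1] := IH _ _ _ s0' rr rK rw.
have [u2 l2] := IH _ _ _ s0' (merge_idem e0 rr) rK' rw'.
rewrite gap_cons //.
have -> : alphas (e :: s) = (edge_defect k L e)%:R + alphas s.
  by rewrite /alphas big_cons natrD.
(* The recurrences of the two parts apply at [(size s).-1] only for nonempty [s]; for empty [s] the
   factor [alphas s] is zero. *)
have [evs ods] : x * odd_part (size s) * alphas s =
      x * (odd_part (size s).-1 + x * even_part (size s).-1) * alphas s /\
    x * even_part (size s) * alphas s =
      x * (even_part (size s).-1 + x * odd_part (size s).-1) * alphas s.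
  case: (s) => [|f t]; first by rewrite /alphas big_nil !mulr0.
  by rewrite /= -odd_partS -even_partS.
rewrite /= !mulrDr evs ods even_partS odd_partS.
by split; lra.
Qed.

(** * Sharper bounds for linear 3-uniform edges *)

Let expkB n j : (j <= n)%N -> k%:R ^+ (n - j) = k%:R ^+ n * x ^+ j.
Proof.
by move=> jn; rewrite -[in RHS](subnK jn) exprD -mulrA -exprMn kx expr1n mulr1.
Qed.

Lemma card_roots_edge e : #|e| = 3%N -> (#|roots (merge id e)| + 2 = #|V|)%N.
Proof.
move=> e3; have e0 : e != set0 by rewrite -card_gt0 e3.
have := card_roots_merge e0 idid.
rewrite imset_id e3 roots_id cardsT; lia.
Qed.

(** Since [f] has at most one vertex in [e], its three vertices stay in three different blocks once
    [e] is contracted, so each edge costs two blocks. *)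
Lemma card_roots_edge2 e f : #|e| = 3%N -> #|f| = 3%N -> (#|e :&: f| <= 1)%N ->
  (#|roots (merge (merge id e) f)| + 4 = #|V|)%N.
Proof.
move=> e3 f3 ef; have e0 : e != set0 by rewrite -card_gt0 e3.
have f0 : f != set0 by rewrite -card_gt0 f3.
have := card_roots_merge f0 (merge_idem e0 idid).
rewrite card_in_imset ?f3; first by have := card_roots_edge e3; lia.
have [w we rE] := mergeP id e0; move=> u v uf vf; rewrite !rE imset_id.
have [ue|ue] := boolP (u \in e); have [ve|ve] := boolP (v \in e) => //.
- by move=> _; apply: (card_le1_eqP ef); rewrite inE ?ue ?ve.
- by move=> wv; rewrite -wv we in ve.
- by move=> uw; rewrite uw we in ue.
Qed.

(** Source of the main term: the block of [e] loses at least [edge_defect k L e] colors, each worth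
    [k ^ (#|V| - 3)] choices on the remaining singleton blocks. *)
Lemma gap_edge_nil e : #|e| = 3%N ->
  k%:R ^+ #|V| * x ^+ 3 * (edge_defect k L e)%:R <= gap (merge id e) [::].
Proof.
move=> e3; have e0 : e != set0 by rewrite -card_gt0 e3.
have V3 : (3 <= #|V|)%N by rewrite -e3 max_card.
have [w we rE] := mergeP id e0.
have rr := merge_idem e0 idid.
rewrite gap_nil // (roots_merge idid we rE) imset_id roots_id setTD.
have wN : w \notin ~: e by rewrite inE we.
have card_C : #|~: e| = (#|V| - 3)%N by rewrite cardsCs setCK e3.
rewrite cardsU1 wN card_C add1n big_setU1 //= -expkB // exprS.
have prod_le : (\prod_(v in ~: e) #|common L (merge id e) v| <= k ^ (#|V| - 3))%N.
  rewrite -card_C -prod_nat_const leq_prod // => v; rewrite inE => ve.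
  by apply: card_common => //; rewrite inE rE imset_id (negPf ve).
have ecP : common L (merge id e) w \subset edge_common L e.
  apply/subsetP => c /commonP cw; rewrite inE; apply/forall_inP => v ve.
  by apply: cw; rewrite rE imset_id ve.
have eck : (#|edge_common L e| <= k)%N.
  rewrite -(cardL w) subset_leq_card //; apply/subsetP => c.
  by rewrite inE => /forall_inP; apply.
rewrite /edge_defect natrB // mulrBr mulrC lerB // -natrX -natrM ler_nat.
by rewrite mulnC leq_mul // subset_leq_card.
Qed.

(** Peeling [f] off [s] adds the gap with both [e] and [f] contracted, which [gap_bounds] controls
    with [K = k ^ #|V| * x ^ 4] because four blocks are gone. The main term comes from the empty
    list. *)
Lemma gap_edge e s : #|e| = 3%N ->
    {in s, forall f, #|f| = 3%N /\ (#|e :&: f| <= 1)%N} ->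
  - gap (merge id e) s <= k%:R ^+ #|V| * x ^+ 4 *
      (odd_part (size s) * (edge_defect k L e)%:R
       + x * even_part (size s).-1 * alphas s)
    - k%:R ^+ #|V| * x ^+ 3 * (edge_defect k L e)%:R.
Proof.
move=> e3; have e0 : e != set0 by rewrite -card_gt0 e3.
have rr := merge_idem e0 idid.
elim: s => [|f s IH] hs.
  have := gap_edge_nil e3; rewrite /alphas big_nil odd_part0; lra.
have hs' : {in s, forall f, #|f| = 3%N /\ (#|e :&: f| <= 1)%N}.
  by move=> g gs; apply: hs; rewrite inE gs orbT.
have [f3 ef] := hs f (mem_head _ _).
have f0 : f != set0 by rewrite -card_gt0 f3.
have cr := card_roots_edge2 e3 f3 ef.
have rK : k%:R ^+ #|roots (merge (merge id e) f)| <= k%:R ^+ #|V| * x ^+ 4 :> R.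
  by rewrite -expkB -?cr ?addnK ?leq_addl.
have rw : (defect k L (merge (merge id e) f))%:R
    <= (edge_defect k L e)%:R + (edge_defect k L f)%:R :> R.
  rewrite -natrD ler_nat; apply: leq_trans (defect_merge cardL f0 rr) _.
  rewrite leq_add2r; apply: leq_trans (defect_merge cardL e0 idid) _.
  by rewrite defect_id.
have s0 : {in s, forall f, f != set0}.
  by move=> g /hs'[g3 _]; rewrite -card_gt0 g3.
have [u _] := gap_bounds s0 (merge_idem f0 rr) rK rw.
rewrite gap_cons //; have {}IH := IH hs'.
have -> : alphas (f :: s) = (edge_defect k L f)%:R + alphas s.
  by rewrite /alphas big_cons natrD.
have evs : x * even_part (size s) * alphas s =
      x * (even_part (size s).-1 + x * odd_part (size s).-1) * alphas s.
  case: (s) => [|g t]; first by rewrite /alphas big_nil !mulr0.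
  by rewrite /= -even_partS.
rewrite /= !mulrDr evs odd_partS.
by lra.
Qed.

(** Deleting the edges one by one charges each set of contracted edges to its first edge, where
    [gap_edge] applies; with no edge left the gap is zero, all lists having size [k]. *)
Lemma gap_le s : uniq s -> {in s, forall e, #|e| = 3%N} ->
    {in s &, forall e f, e != f -> (#|e :&: f| <= 1)%N} ->
  gap id s <= - (k%:R ^+ #|V| * x ^+ 3 * (1 - x * odd_part (size s).-1) * alphas s).
Proof.
elim: s => [_ _ _|e s IH /= /andP[es us] s3 sl].
  rewrite gap_nil // (eq_bigr (fun=> k)) => [|v _]; last by rewrite common_id.
  by rewrite prod_nat_const natrX subrr /alphas big_nil mulr0 oppr0.
have s3' : {in s, forall e, #|e| = 3%N} by move=> f fs; apply: s3; rewrite inE fs orbT.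
have e3 := s3 e (mem_head _ _).
have e0 : e != set0 by rewrite -card_gt0 e3.
have sl' : {in s &, forall e f, e != f -> (#|e :&: f| <= 1)%N}.
  by move=> f g fs gs; apply: sl; rewrite inE ?fs ?gs orbT.
have hs : {in s, forall f, #|f| = 3%N /\ (#|e :&: f| <= 1)%N}.
  move=> f fs; split; first exact: s3'.
  apply: sl; rewrite ?mem_head ?inE ?fs ?orbT //.
  by apply: contraNneq es => ->.
have {}IH := IH us s3' sl'; have := gap_edge e3 hs.
rewrite gap_cons // => ge.
have -> : alphas (e :: s) = (edge_defect k L e)%:R + alphas s.
  by rewrite /alphas big_cons natrD.
have ods : x * odd_part (size s) * alphas s =
      x * (odd_part (size s).-1 + x * even_part (size s).-1) * alphas s.
  case: (s) => [|g t]; first by rewrite /alphas big_nil !mulr0.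
  by rewrite /= -odd_partS.
have := congr1 (fun t => k%:R ^+ #|V| * x ^+ 3 * t) ods.
by lra.
Qed.

End Bounds.
End Contraction.

(** * From lists of natural numbers to a finite type of colors *)

Lemma card_imfset_set (T : finType) (U : choiceType) (f : T -> U) (S : {set T}) :
  injective f -> #|` [fset f t | t in S]%fset| = #|S|.
Proof. by move=> f_inj; rewrite card_imfset //= -cardE. Qed.

Section Bounded.
Variables (V : finType) (N : nat).
Implicit Types (L : V -> {fset nat}) (F : {fset nat}).

Definition bounded_set F : {set 'I_N} := [set c | val c \in F].

Lemma card_bounded_set F : (forall c, c \in F -> (c < N)%N) -> #|bounded_set F| = #|` F|.
Proof.
move=> FN; rewrite -(card_imfset_set _ val_inj); congr #|` _|.
apply/fsetP => c; apply/imfsetP/idP => [[d /=]|cF]; first by rewrite inE => ? ->.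
by exists (Ordinal (FN c cF)); rewrite // inE.
Qed.

Lemma two_colorsE (C : choiceType) (g : V -> C) (e : {set V}) :
  (1 < #|` [fset g v | v in e]%fset|)%N = ~~ [forall u in e, forall v in e, g u == g v].
Proof.
apply/idP/idP => [|/forall_inPn[u ue /forall_inPn[v ve guv]]].
  apply: contraL => /forall_inP h; rewrite -leqNgt.
  have [->|[a ae]] := fset_0Vmem [fset g v | v in e]%fset; first by rewrite cardfs0.
  rewrite -(cardfs1 a); apply/fsubset_leq_card/fsubsetP => b /imfsetP[v /= ve ->].
  by case/imfsetP: ae => u /= ue ->; rewrite inE (forall_inP (h v ve)).
rewrite -[2%N](_ : #|` [fset g u; g v]%fset| = 2%N); last by rewrite cardfs2 guv.
apply/fsubset_leq_card/fsubsetP => b; rewrite !inE.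
by case/orP => /eqP ->; apply: in_imfset.
Qed.

Lemma list_color_countE (H : hypergraph V) L :
    (forall v c, c \in L v -> (c < N)%N) ->
  list_color_count H L = num_colorings (fun v => bounded_set (L v)) id (enum (edges H)).
Proof.
move=> LN; pose f (theta : {ffun V -> 'I_N}) := [ffun v => val (theta v)] : {ffun V -> nat}.
have f_inj : injective f.
  by move=> t1 t2 /ffunP e12; apply/ffunP => v; apply/val_inj; move: (e12 v); rewrite !ffunE.
rewrite /list_color_count /num_colorings -(card_imfset_set _ f_inj); congr #|` _|.
rewrite -[RHS]cardinality.set_fsetK; congr cardinality.fset_set.
have monoE (theta : {ffun V -> 'I_N}) (e : {set V}) :
    (1 < #|` [fset f theta v | v in e]%fset|)%N = ~~ mono theta e.
  rewrite two_colorsE; congr (~~ _); apply: eq_forallb_in => u _.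
  by apply: eq_forallb_in => v _; rewrite !ffunE.
apply/classical_sets.seteqP; split=> theta.
  move=> [tL tH]; apply/imfsetP; exists [ffun v => Ordinal (LN v _ (tL v))].
    rewrite /= !inE; apply/andP; split.
      by apply/forallP => v; rewrite eqxx inE ffunE /= tL.
    apply/allP => e; rewrite mem_enum => /tH; rewrite -monoE.
    suff <- : theta = f [ffun v => Ordinal (LN v _ (tL v))] by [].
    by apply/ffunP => v; rewrite !ffunE.
  by apply/ffunP => v; rewrite !ffunE.
case/imfsetP=> t /=; rewrite inE => /andP[/forallP tL /allP tH] ->; split.
  by move=> v; have /andP[] := tL v; rewrite inE ffunE.
by move=> e eH; rewrite /= monoE tH // mem_enum.
Qed.

Lemma alpha_edgeE (k : nat) L (e : {set V}) : e != set0 ->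
    (forall v c, c \in L v -> (c < N)%N) ->
  alpha_edge k L e = edge_defect k (fun v => bounded_set (L v)) e.
Proof.
case/set0Pn=> w we LN; rewrite /alpha_edge /edge_defect; congr (_ - _)%N.
have ecE c : (c \in edge_common_colors L e) = [forall v in e, c \in L v].
  rewrite !inE andb_idl // => /forall_inP h.
  by apply/bigfcupP; exists w; rewrite ?h // mem_index_enum.
rewrite -card_bounded_set => [|c]; last by rewrite ecE => /forall_inP/(_ w we)/LN.
apply: eq_card => c; rewrite [LHS]inE ecE [RHS]inE; apply: eq_forallb_in => v _.
by rewrite inE.
Qed.

End Bounded.

Lemma gap_list_colorings (R : realFieldType) (V : finType) (H : hypergraph V)
    (k : nat) (L : V -> {fset nat}) :
    linear_hypergraph H -> uniform_hypergraph 3 H -> (0 < k)%N -> assignment k L ->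
  (chromatic_count H k)%:R - (list_color_count H L)%:R
    <= - (k%:R ^+ #|V| * k%:R^-1 ^+ 3 *
          (1 - k%:R^-1 * odd_part R k #|edges H|.-1) * (alpha k H L)%:R) :> R.
Proof.
(* [N] exceeds every color of [L], each being at most the sum of all of them, and every color of the
   constant list. *)
move=> Hlin H3 k0 Lk; pose N := (k + \sum_v \sum_(c <- L v) c).+1.
have LN v c : c \in L v -> (c < N)%N.
  move=> cL; rewrite ltnS (bigD1 v) //= (big_rem c cL) /=; lia.
have kN (T : finType) (v : T) c : c \in @constant_assignment T k v -> (c < N)%N.
  by rewrite !inE mem_iota add1n ltnS => /andP[_ ck]; rewrite ltnS (leq_trans ck) ?leq_addr.
have card_lists (v : V) : #|bounded_set N (L v)| = k.
  by rewrite card_bounded_set; [case: (Lk v)|apply: LN].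
(* The constant list is read off at [unit], so that no vertex of [V] has to be supplied. *)
have card_iota : #|bounded_set N (@constant_assignment unit k tt)| = k.
  by rewrite card_bounded_set; [case: (@constant_assignmentP unit k tt)|apply: (kN unit tt)].
rewrite /chromatic_count proper_coloringsE.
rewrite -[#|` _|]/(list_color_count H (@constant_assignment V k)).
rewrite (list_color_countE H LN) (list_color_countE H (kN V)).
have uniform e : e \in enum (edges H) -> #|e| = 3%N by rewrite mem_enum; apply: H3.
have linear : {in enum (edges H) &, forall e f, e != f -> (#|e :&: f| <= 1)%N}.
  by move=> e f; rewrite !mem_enum; apply: Hlin.
have := gap_le R k0 card_iota card_lists (enum_uniq (edges H)) uniform linear.
rewrite /gap -cardE => gle; apply: le_trans gle _.
rewrite lerN2; suff -> : alpha k H L = (\sum_(e <- enum (edges H))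
    edge_defect k (fun v => bounded_set N (L v)) e)%N by [].
rewrite /alpha big_enum; apply: eq_bigr.
move=> e eH; apply: alpha_edgeE => //.
by rewrite -card_gt0 H3.
Qed.

(** * Numerical estimates behind the constants 1.185, 0.156 and 0.002 *)

Lemma expR1_ge (R : realType) : 2718%:R / 1000%:R <= expR 1 :> R.
Proof.
have nd : {homo series (exp_coeff (1 : R)) : m n / (m <= n)%N >-> m <= n}.
  by apply: nondecreasing_series => n _ _; rewrite exp_coeff_ge0.
(* Seven terms, up to [1/6!], already sum to more than 2.71805. *)
apply: le_trans (nondecreasing_cvgn_le nd (is_cvg_series_exp_coeff (1 : R)) 7).
rewrite /series /= /exp_coeff /= !big_nat_recr //= big_nil !expr1n !factS fact0 /=.
lra.
Qed.

(** Applied with [n = m - 1]. The odd part is below [exp(n/k) / 2], and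
    [exp(n/k) <= n^(1/1.185) <= n^0.844], so the subtracted term is below
    [ln n / (2.37 * n^0.156)]. *)
Lemma odd_tail_lt (R : realType) (n k : nat) : (1 < n)%N -> (0 < k)%N ->
    (1185%:R / 1000%:R) * n%:R / ln n%:R <= k%:R :> R ->
  (2%:R / 1000%:R) * ln n%:R / (n%:R `^ (156%:R / 1000%:R))
    < 1 - k%:R^-1 * (((1 + k%:R^-1) ^+ n - (1 - k%:R^-1) ^+ n) / 2%:R) :> R.
Proof.
move=> n1 k0 nk; set X : R := n%:R in nk *; set x : R := k%:R^-1.
have X0 : 0 < X by rewrite ltr0n ltnW.
have X1 : 1 < X by rewrite ltr1n.
set l : R := ln X in nk *; have l0 : 0 < l by rewrite ln_gt0.
have Xl : X = expR l by rewrite lnK.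
have kR0 : 0 < k%:R :> R by rewrite ltr0n.
have x0 : 0 < x by rewrite invr_gt0.
have x_le : x * (1185%:R / 1000%:R * X) <= l.
  by move: nk; rewrite ler_pdivrMr // mulrC => nk; rewrite /x ler_pdivrMl // mulrC [_ * l]mulrC.
have x_lt1 : x < 1.
  have lX : l < X by rewrite /l ln_sublinear.
  have : x * X < 1 * X by nra.
  by rewrite ltr_pM2r.
have pow_lt : (1 + x) ^+ n - (1 - x) ^+ n < expR (x * X).
  rewrite /X expRM_natr; apply: lt_le_trans (_ : (1 + x) ^+ n <= _).
    by rewrite ltrBlDr ltrDl exprn_gt0 // subr_gt0.
  by rewrite lerXn2r ?nnegrE ?expR_ge0 ?expR_ge1Dx // addr_ge0 // ltW.
have -> : X `^ (156%:R / 1000%:R) = expR (156%:R / 1000%:R * l).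
  by rewrite /powR gt_eqF.
set p : R := expR (156%:R / 1000%:R * l); have p0 : 0 < p by rewrite expR_gt0.
(* The exponents fit because [1/1.185 + 0.156 < 1]. *)
have exp_le : expR (x * X) * p <= X.
  by rewrite -expRD Xl ler_expR -Xl; nra.
have p_ge : (2718%:R / 1000%:R) * (156%:R / 1000%:R * l) <= p.
  (* e * u <= e ^ u with u = 0.156 l *)
  have -> : p = expR 1 * expR (156%:R / 1000%:R * l - 1).
    by rewrite -expRD addrC subrK.
  have := expR_ge1Dx (156%:R / 1000%:R * l - 1); rewrite addrC subrK => u.
  by apply: ler_pM => //; rewrite ?expR1_ge //; nra.
set q := expR (x * X) in pow_lt exp_le.
have q0 : 0 < q by rewrite expR_gt0.
have main : x * q * p * (1185%:R / 1000%:R) <= l.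
  have := ler_wpM2l (ltW x0) exp_le; lra.
rewrite -(ltr_pM2r p0) mulfVK ?gt_eqF //.
set y := _ - _ in pow_lt *.
have : x * y * p < x * q * p by rewrite ltr_pM2r // ltr_pM2l.
(* After multiplication by [p] it remains that [0.002 + 1/2.37 < 2.718 * 0.156], that is, about
   0.42394 against 0.42401, times [l > 0]. *)
lra.
Qed.

Unset Implicit Arguments.
Set Strict Implicit.

Theorem theorem2 (R : realType) (V : finType) (H : hypergraph V) (n m : nat)
    (n_vertices : #|V| = n) (m_edges : #|edges H| = m)
    (H_linear : linear_hypergraph H) (H_uniform : uniform_hypergraph 3 H)
    (m_ge3 : (3 <= m)%N) :
  (forall (k : nat) (L : V -> {fset nat}),
     (0 < k)%N ->
     (1185%:R / 1000%:R) * (m%:R - 1) / ln (m%:R - 1) <= k%:R :> R ->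
     assignment k L ->
     (0 < alpha k H L)%N ->
     (2%:R / 1000%:R) * ln (m%:R - 1) / ((m%:R - 1) `^ (156%:R / 1000%:R))
       * k%:R ^+ (n - 3) * (alpha k H L)%:R
     < (list_color_count H L)%:R - (chromatic_count H k)%:R :> R)
  /\
  (forall k : nat,
     (0 < k)%N ->
     (1185%:R / 1000%:R) * (m%:R - 1) / ln (m%:R - 1) <= k%:R :> R ->
     list_color_function H k = chromatic_count H k).
Proof.
have m1 : m%:R - 1 = m.-1%:R :> R by rewrite -subn1 natrB // (leq_trans _ m_ge3).
(* An edge exists, so the subtraction in [n - 3] is exact. *)
have n3 : (3 <= n)%N.
  have /card_gt0P[e eH] : (0 < #|edges H|)%N by rewrite m_edges (leq_trans _ m_ge3).
  by rewrite -(H_uniform _ eH) -n_vertices max_card.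
rewrite m1.
have coef_pos (k : nat) : (0 < k)%N ->
    (1185%:R / 1000%:R) * m.-1%:R / ln m.-1%:R <= k%:R :> R ->
    2%:R / 1000%:R * ln m.-1%:R / m.-1%:R `^ (156%:R / 1000%:R)
      < 1 - k%:R^-1 * odd_part R k m.-1.
  by move=> k0; apply: odd_tail_lt => //; case: m m_ge3 {m_edges m1} => [|[|[|]]].
have kn3 (k : nat) : (0 < k)%N -> k%:R ^+ n * k%:R^-1 ^+ 3 = k%:R ^+ (n - 3) :> R.
  move=> k0; rewrite -[in LHS](subnK n3) exprD -mulrA -exprMn divff ?expr1n ?mulr1 //.
  by rewrite pnatr_eq0 -lt0n.
split=> [k L k0 km Lk a0|k k0 km].
  have := gap_list_colorings R H_linear H_uniform k0 Lk.
  rewrite n_vertices m_edges kn3 // => gle.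
  apply: lt_le_trans (_ : k%:R ^+ (n - 3) * (1 - k%:R^-1 * odd_part R k m.-1)
    * (alpha k H L)%:R <= _); last by rewrite -lerN2 opprB.
  rewrite ltr_pM2r ?ltr0n // mulrC ltr_pM2l ?exprn_gt0 ?ltr0n //; exact: coef_pos.
(* The same bound in weak form, which also covers assignments with [alpha k H L = 0]. *)
have list_ge (L : V -> {fset nat}) : assignment k L ->
    (chromatic_count H k <= list_color_count H L)%N.
  move=> Lk; have := gap_list_colorings R H_linear H_uniform k0 Lk.
  rewrite n_vertices m_edges kn3 // => gle.
  rewrite -(ler_nat R) -subr_le0; apply: (le_trans gle); rewrite oppr_le0.
  rewrite !mulr_ge0 ?exprn_ge0 ?ler0n //; apply: le_trans (ltW (coef_pos k k0 km)).
  rewrite divr_ge0 ?powR_ge0 // mulr_ge0 ?divr_ge0 // ln_ge0 // ler1n.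
  by case: m m_ge3 {m_edges m1 kn3 coef_pos gle km} => [|[|]].
(* The minimum is at most the count for the constant assignment, whose list colorings are the proper
   colorings; [list_ge] gives the other inequality. *)
rewrite /list_color_function; case: ex_minnP => j /boolp.asboolP[L Lk <-] j_min.
apply/eqP; rewrite eqn_leq list_ge // andbT j_min //; apply/boolp.asboolP.
exists (@constant_assignment V k); first exact: constant_assignmentP.
by rewrite /chromatic_count proper_coloringsE.
Qed.
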